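(* Let $\mathbb{Y}$ be a subspace of $\ell_1^n$ and let $\mathcal{A}=\{\widetilde{a_1},\ldots,\widetilde{a_m}\}$ be a basis of $\mathbb{Y}$ with $\mathcal{Z}_{\mathcal{A}}=\emptyset$, where $\widetilde{a_k}=(a_1^k,\ldots,a_n^k)$. Suppose that $\mathcal{N}=\{\pm\widetilde{x_1},\pm\widetilde{x_2},\ldots,\pm\widetilde{x_q}\}$ is the minimal norming set of $\mathbb{Y}$, where $\widetilde{x_k}=(x_1^k,\ldots,x_n^k)$ for $1\le k\le q$. Let $\widetilde{b}=(b_1,\ldots,b_n)\in\ell_1^n$ and $\alpha_1,\ldots,\alpha_m\in\mathbb{R}$. Then $\sum_{k=1}^m\alpha_k\widetilde{a_k}$ is a best coapproximation to $\widetilde{b}$ out of $\mathbb{Y}$ if and only if \[ \alpha_1\sum_{i=1}^n a_i^1x_i^p+\alpha_2\sum_{i=1}^n a_i^2x_i^p+\cdots+\alpha_m\sum_{i=1}^n a_i^mx_i^p=\sum_{i=1}^n b_ix_i^p \] for every $p\in\{1,2,\ldots,q\}$.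
   Context: $\ell_1^n$ and $\ell_\infty^n$ denote $\mathbb{R}^n$ with the norms $\sum_i|x_i|$ and $\max_i|x_i|$ respectively. For a linearly independent set $\mathcal{A}=\{\widetilde{a_1},\ldots,\widetilde{a_m}\}$ in $\ell_1^n$ with $\widetilde{a_k}=(a^k_1,\ldots,a^k_n)$, the zero set is $\mathcal{Z}_{\mathcal{A}}=\{i\in\{1,\ldots,n\}:(a_i^1,\ldots,a_i^m)=(0,\ldots,0)\}$. $\psi:\ell_1^n\to(\ell_\infty^n)^*$ is the canonical isometric isomorphism, $\psi(a_1,\ldots,a_n)(x_1,\ldots,x_n)=\sum_{i=1}^n a_ix_i$. For $g\in(\ell_\infty^n)^*$, $M_g=\{x\in\ell_\infty^n:\|x\|=1,\ |g(x)|=\|g\|\}$. $\mathrm{Ext}(B_{\ell_\infty^n})$ is the set of extreme points of the closed unit ball of $\ell_\infty^n$. A set $S$ is symmetric if $x\in S$ implies $-x\in S$. A symmetric set $\mathcal{N}$ is a norming set of a subspace $\mathbb{Y}\subset\ell_1^n$ if $(M_g\cap\mathrm{Ext}(B_{\ell_\infty^n}))\cap\mathcal{N}\ne\emptyset$ for each $g\in\psi(\mathbb{Y})$. A norming set $\mathcal{N}$ of $\mathbb{Y}$ is a minimal norming set of $\mathbb{Y}$ if, for every norming set $\mathcal{M}$ of $\mathbb{Y}$, $\mathcal{M}\subset\mathcal{N}$ implies $\mathcal{M}=\mathcal{N}$. When $\mathcal{Z}_{\mathcal{A}}=\emptyset$ there is exactly one minimal norming set of $\mathbb{Y}$, called the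 minimal norming set. An element $y_0\in\mathbb{Y}$ is a best coapproximation to $x$ out of $\mathbb{Y}$ if $\|y_0-y\|\le\|x-y\|$ for all $y\in\mathbb{Y}$. *)

(* Defs.v *)
From HB Require Import structures.
From mathcomp Require Import all_boot all_order all_algebra.
From mathcomp Require Import all_classical all_reals all_analysis.
Set Implicit Arguments.
Unset Strict Implicit.
Unset Printing Implicit Defensive.
Import Order.TTheory GRing.Theory Num.Theory.
Import numFieldNormedType.Exports.
Local Open Scope classical_set_scope.
Local Open Scope ring_scope.

(* Both l_1^n and l_oo^n have carrier 'rV[R]_n.  The library norm `|x| on
   'rV[R]_n is the maximum norm, so it is used for l_oo^n; the norm of l_1^n
   is l1norm. *)
Definition l1norm (R : realType) (n : nat) (x : 'rV[R]_n) : R :=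
  \sum_(i < n) `|x 0 i|.

Definition zero_set (R : realType) (n m : nat) (A : m.-tuple 'rV[R]_n) :
    set 'I_n :=
  [set i | forall k : 'I_m, (tnth A k) 0 i = 0].

Section Psi.
Variables (R : realType) (n : nat).

Definition psi_fun (a x : 'rV[R]_n) : R := \sum_(i < n) a 0 i * x 0 i.

Lemma psi_fun_scalar (a : 'rV[R]_n) : scalar (psi_fun a).
Proof.
move=> c u v; rewrite /psi_fun mulr_sumr -big_split /=.
by apply: eq_bigr => i _; rewrite !mxE mulrDr mulrCA.
Qed.

HB.instance Definition _ (a : 'rV[R]_n) :=
  GRing.isLinear.Build R 'rV[R]_n R *%R (psi_fun a) (psi_fun_scalar a).

(* In finite dimension every linear form is continuous, so {scalar 'rV[R]_n}
   is the dual of l_oo^n. *)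
Definition psi (a : 'rV[R]_n) : {scalar 'rV[R]_n} := psi_fun a.

End Psi.

Definition unit_ball_linfty (R : realType) (n : nat) : set 'rV[R]_n :=
  [set x | `|x| <= 1].

Definition dual_norm (R : realType) (n : nat) (g : {scalar 'rV[R]_n}) : R :=
  sup [set `|g x| | x in @unit_ball_linfty R n].

Definition norm_attain (R : realType) (n : nat) (g : {scalar 'rV[R]_n}) :
    set 'rV[R]_n :=
  [set x | `|x| = 1 /\ `|g x| = dual_norm g].

Definition extreme_points (R : realType) (V : lmodType R) (C : set V) : set V :=
  [set x | C x /\ forall (u v : V) (t : R), C u -> C v -> 0 < t -> t < 1 ->
             x = t *: u + (1 - t) *: v -> u = x /\ v = x].

Definition symmetric_set (V : zmodType) (S : set V) : Prop :=
  forall x, S x -> S (- x).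

Definition norming_set (R : realType) (n : nat) (Y : {vspace 'rV[R]_n})
    (N : set 'rV[R]_n) : Prop :=
  symmetric_set N /\
  forall g : {scalar 'rV[R]_n}, [set psi y | y in [set` Y]] g ->
    norm_attain g `&` extreme_points (@unit_ball_linfty R n) `&` N !=set0.

Definition minimal_norming_set (R : realType) (n : nat)
    (Y : {vspace 'rV[R]_n}) (N : set 'rV[R]_n) : Prop :=
  norming_set Y N /\
  forall M : set 'rV[R]_n, norming_set Y M -> M `<=` N -> M = N.

Definition best_coapproximation (R : realType) (n : nat)
    (Y : {vspace 'rV[R]_n}) (x y0 : 'rV[R]_n) : Prop :=
  y0 \in Y /\ forall y, y \in Y -> l1norm (y0 - y) <= l1norm (x - y).

(* Main.v *)
(* Every y in Y with full support attains its norm, among points of the unit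
   ball, only at sgn y and - sgn y, so these lie in every norming set.
   Conversely, as the zero set is empty, every element of Y can be perturbed
   inside Y to one with full support without changing its nonzero signs, so
   these sign vectors already form a norming set: the minimal one.  Thus each
   x_p is sgn y for some full-support y in Y, and |w + t y|_1 = psi(w + t y)(x_p)
   for t large; comparing y0 and b against -t y and t y gives the equations.
   The converse evaluates psi(y0 - y) at a norming point of N. *)
Require Import Defs.
From mathcomp Require Import all_boot all_order all_algebra.
From mathcomp Require Import all_classical all_reals all_analysis.
From mathcomp Require Import lra.
Import Order.TTheory GRing.Theory Num.Theory.
Import numFieldNormedType.Exports.
Local Open Scope classical_set_scope.
Local Open Scope ring_scope.

(** * Sign vectors and the dual norm *)

Section SignVectors.
Set Implicit Arguments.
Unset Strict Implicit.
Variables (R : realType) (n : nat).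
Implicit Types x y z u v w : 'rV[R]_n.

Definition sgv y : 'rV[R]_n := map_mx Num.sg y.

Definition full_support y := forall i, y 0 i != 0.

Lemma rV_norm_leP x (r : R) :
  0 <= r -> reflect (forall i, `|x 0 i| <= r) (`|x| <= r).
Proof.
move=> r0; have -> : `|x| = \big[Num.max/0]_ij `|x ij.1 ij.2|.
  exact: mx_normrE.
apply: (iffP idP) => [xr i|xr].
  by apply: le_trans xr; apply: (le_bigmax _ (fun ij => `|x ij.1 ij.2|) (0, i)).
by apply: bigmax_le => // -[j i] _ /=; rewrite ord1.
Qed.

Lemma psi_funC x y : psi_fun x y = psi_fun y x.
Proof. by apply: eq_bigr => i _; rewrite mulrC. Qed.

(** Coordinates where [y] vanishes are left free, so the sign vector of a full-support perturbation
    of [y] still norms [y]. *)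
Lemma psi_sgv y z : (forall i, y 0 i != 0 -> Num.sg (z 0 i) = Num.sg (y 0 i)) ->
  psi_fun y (sgv z) = l1norm y.
Proof.
move=> zy; apply: eq_bigr => i _; rewrite mxE.
have [->|y0] := eqVneq (y 0 i) 0; first by rewrite normr0 mul0r.
by rewrite zy// mulrC -normrEsg.
Qed.

Lemma normr_psi_le y x : `|x| <= 1 -> `|psi_fun y x| <= l1norm y.
Proof.
move=> /(rV_norm_leP _ ler01) x1; apply: le_trans (ler_norm_sum _ _ _) _.
by apply: ler_sum => i _; rewrite normrM ler_piMr.
Qed.

Lemma sgv_le1 y : `|sgv y| <= 1.
Proof.
by apply/(rV_norm_leP _ ler01) => i; rewrite mxE normr_sg; case: eqP.
Qed.

Lemma dual_norm_psi y : dual_norm (psi y) = l1norm y.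
Proof.
set S := [set `|psi y x| | x in @unit_ball_linfty R n].
have Sy : ubound S (l1norm y) by move=> _ [x x1 <-]; exact: normr_psi_le.
have yS : S (l1norm y).
  exists (sgv y); first exact: sgv_le1.
  by rewrite /= psi_sgv// ger0_norm// sumr_ge0.
apply/le_anti/andP; split; first by apply: ge_sup => //; exists (l1norm y).
by apply: ub_le_sup yS; exists (l1norm y).
Qed.

Lemma norm_sgv y : (0 < n)%N -> full_support y -> `|sgv y| = 1.
Proof.
move=> n0 fy; apply/le_anti; rewrite sgv_le1/=.
have := (rV_norm_leP (sgv y) (normr_ge0 _)) (lexx _).
by move=> /(_ (Ordinal n0)); rewrite mxE normr_sg fy.
Qed.

Lemma sgv_extreme y : full_support y ->
  extreme_points (@unit_ball_linfty R n) (sgv y).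
Proof.
move=> fy; split=> [|u v t u1 v1 t0 t1 E]; first exact: sgv_le1.
have {}u1 := (rV_norm_leP u ler01) u1.
have {}v1 := (rV_norm_leP v ler01) v1.
suff uv i : u 0 i = sgv y 0 i /\ v 0 i = sgv y 0 i.
  by split; apply/rowP => i; have [] := uv i.
have := congr1 (fun M : 'rV_n => M 0 i) E; rewrite !mxE.
have /andP[u2 u3] : -1 <= u 0 i <= 1 by rewrite -ler_norml.
have /andP[v2 v3] : -1 <= v 0 i <= 1 by rewrite -ler_norml.
have [y0|y0|y0] := sgrP (y 0 i); first by have := fy i; rewrite y0 eqxx.
(* Here [t * (1 - u 0 i)] and [(1 - t) * (1 - v 0 i)] are nonnegative and sum to 0; the negative
   case mirrors this. *)
- move=> e.
  have : t * (1 - u 0 i) = 0 by nra.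
  have : (1 - t) * (1 - v 0 i) = 0 by nra.
  move/eqP; rewrite mulf_eq0 => /orP[/eqP|/eqP ?]; first lra.
  by move/eqP; rewrite mulf_eq0 => /orP[/eqP|/eqP ?]; lra.
- move=> e.
  have : t * (1 + u 0 i) = 0 by nra.
  have : (1 - t) * (1 + v 0 i) = 0 by nra.
  move/eqP; rewrite mulf_eq0 => /orP[/eqP|/eqP ?]; first lra.
  by move/eqP; rewrite mulf_eq0 => /orP[/eqP|/eqP ?]; lra.
Qed.

Lemma psi_eq_l1norm y z : full_support y -> `|z| <= 1 ->
  psi_fun y z = l1norm y -> z = sgv y.
Proof.
move=> fy /(rV_norm_leP _ ler01) z1 yz.
(* Equality of the two sums forces equality term by term, since each difference is nonnegative. *)
have yz_ge0 i : true -> 0 <= `|y 0 i| - y 0 i * z 0 i.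
  move=> _; rewrite subr_ge0; apply: le_trans (ler_norm _) _.
  by rewrite normrM ler_piMr.
have yz0 : \sum_(i < n) (`|y 0 i| - y 0 i * z 0 i) = 0.
  by rewrite sumrB -/(l1norm y) -/(psi_fun y z) yz subrr.
apply/rowP => i; have /eqP := psumr_eq0P yz_ge0 yz0 (i := i) isT.
rewrite mxE subr_eq0 normrEsg mulrC => /eqP /(mulfI (fy i)).
by [].
Qed.

Lemma norm_attain_full_support y z : full_support y -> norm_attain (psi y) z ->
  z = sgv y \/ z = - sgv y.
Proof.
move=> fy [z1]; rewrite dual_norm_psi /= => yz.
have [yz0|yz0] := leP 0 (psi_fun y z); [left|right].
  by apply: psi_eq_l1norm; rewrite ?z1// -yz ger0_norm.
rewrite -[z]opprK; congr (- _); apply: psi_eq_l1norm; rewrite ?normrN ?z1//.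
by rewrite linearN /= -yz ltr0_norm.
Qed.

Lemma dominating_scale y u : exists T : R,
  forall t i, T <= t -> y 0 i != 0 ->
    Num.sg ((t *: y + u) 0 i) = Num.sg (y 0 i).
Proof.
(* The sum bounds each ratio with [y 0 i != 0], and the 1 makes the bound strict; terms with
   [y 0 i = 0] are 0, as division by 0 gives 0. *)
exists (1 + \sum_(i < n) `|u 0 i| / `|y 0 i|).
move=> t i Tt y0; rewrite !mxE.
have ut : `|u 0 i| < t * `|y 0 i|.
  rewrite -ltr_pdivrMr ?normr_gt0//; apply: lt_le_trans Tt.
  by rewrite (bigD1 i)//= addrCA ltrDl ltr_pwDl// sumr_ge0.
move: ut; rewrite lter_norml => /andP[u1 u2].
have /orP[y1|y1] : (y 0 i < 0) || (0 < y 0 i) by rewrite -neq_lt.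
  rewrite (ltr0_norm y1) in u1 u2; rewrite (ltr0_sg y1) ltr0_sg//; lra.
rewrite (gtr0_norm y1) in u1 u2; rewrite (gtr0_sg y1) gtr0_sg//; lra.
Qed.

(** * The minimal norming set as a set of sign vectors *)

Section MinimalNormingSet.
Variable Y : {vspace 'rV[R]_n}.

Lemma full_support_exists : (forall i, exists2 u, u \in Y & u 0 i != 0) ->
  exists2 y, y \in Y & full_support y.
Proof.
move=> Yi; suff [y yY ys] : exists2 y, y \in Y &
    forall i, i \in enum 'I_n -> y 0 i != 0.
  by exists y => // i; apply: ys; rewrite mem_enum.
elim: (enum _) => [|i s [y yY ys]]; first by exists 0; rewrite ?mem0v.
have [yi|yi] := eqVneq (y 0 i) 0; last first.
  by exists y => // j; rewrite inE => /predU1P[->//|]; exact: ys.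
have [u uY ui] := Yi i; have [T yu] := dominating_scale y u.
(* The large multiple of [y] protects the coordinates already nonzero, while [u] supplies coordinate
   [i], where [y] vanishes. *)
exists (T *: y + u); first by rewrite memvD ?memvZ.
move=> j; rewrite inE => /predU1P[->|/ys yj].
  by rewrite !mxE yi mulr0 add0r.
by rewrite -sgr_eq0 yu// sgr_eq0.
Qed.

Definition sgv_set : set 'rV[R]_n :=
  [set z | exists y, [/\ y \in Y, full_support y & z = sgv y]].

Lemma sgv_set_sub N : norming_set Y N -> sgv_set `<=` N.
Proof.
move=> [symN norN] _ [y [yY fy ->]].
have [|z [[zy _] zN]] := norN (psi y); first by exists y.
have [<-//|zE] := norm_attain_full_support fy zy.
by rewrite -[sgv y]opprK -zE; exact: symN.
Qed.

Lemma sgv_set_norming : (0 < n)%N ->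
  (forall i, exists2 u, u \in Y & u 0 i != 0) -> norming_set Y sgv_set.
Proof.
move=> n0 Yi; split=> [_ [y [yY fy ->]]|_ [y yY <-]].
  exists (- y); split; first by rewrite memvN.
    by move=> i; rewrite mxE oppr_eq0.
  by apply/rowP => i; rewrite !mxE sgrN.
have [u uY fu] := full_support_exists Yi.
have [T yu] := dominating_scale y u.
have fw : full_support (T *: y + u).
  move=> i; have [yi|yi] := eqVneq (y 0 i) 0.
    by rewrite !mxE yi mulr0 add0r.
  by rewrite -sgr_eq0 yu// sgr_eq0.
exists (sgv (T *: y + u)); split; last first.
  by exists (T *: y + u); split; rewrite // memvD ?memvZ.
split; last exact: sgv_extreme.
split; first exact: norm_sgv.
rewrite dual_norm_psi /= psi_sgv => [|i]; last exact: yu.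
by rewrite ger0_norm// sumr_ge0.
Qed.

Lemma minimal_norming_setE N : (0 < n)%N ->
  (forall i, exists2 u, u \in Y & u 0 i != 0) ->
  minimal_norming_set Y N -> N = sgv_set.
Proof.
move=> n0 Yi [norN minN]; apply/esym/minN; last exact: sgv_set_sub.
exact: sgv_set_norming.
Qed.

(** Even the zero functional needs a norming point of norm 1, and in dimension 0 every norm is 0. *)
Lemma norming_set_dim_gt0 N : norming_set Y N -> (0 < n)%N.
Proof.
move=> [_ norN]; have [|z [[[z1 _] _] _]] := norN (psi 0).
  by exists 0; rewrite //= mem0v.
rewrite lt0n; apply: contra_eqN z1 => /eqP n0.
rewrite lt_eqF// (@le_lt_trans _ _ 0)//; apply/rV_norm_leP => // i.
by have := leq_trans (ltn_ord i) (eq_leq n0).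
Qed.

(** * Best coapproximation tested at norming points *)

Lemma coapprox_of_norming N y0 b : norming_set Y N -> y0 \in Y ->
  (forall z, N z -> psi_fun y0 z = psi_fun b z) ->
  best_coapproximation Y b y0.
Proof.
move=> [_ norN] y0Y y0b; split=> // y yY.
have [|z [[[z1 yz] _] Nz]] := norN (psi (y0 - y)).
  by exists (y0 - y); rewrite //= memvB.
rewrite -dual_norm_psi -yz /=.
have -> : psi_fun (y0 - y) z = psi_fun (b - y) z.
  (* Linearity is registered only in the second argument of [psi_fun], hence the swaps. *)
  by rewrite !(psi_funC _ z) !linearB /= !(psi_funC z) y0b.
by apply: normr_psi_le; rewrite z1.
Qed.

Lemma coapprox_psi_le y0 b y : best_coapproximation Y b y0 ->
  y \in Y -> full_support y ->
  psi_fun y0 (sgv y) <= psi_fun b (sgv y).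
Proof.
move=> [y0Y y0b] yY fy.
have [T0 yT0] := dominating_scale y y0.
have [T1 yT1] := dominating_scale y b.
set T := Num.max T0 T1.
have sgv_add w : (forall i, Num.sg ((T *: y + w) 0 i) = Num.sg (y 0 i)) ->
    l1norm (T *: y + w) = psi_fun (T *: y + w) (sgv y).
  by move=> wy; rewrite psi_sgv// => i _; rewrite wy.
(* Both [T *: y + y0] and [T *: y + b] have the signs of [y], so both norms are values at [sgv y]
   and the common term from [T *: y] cancels. *)
have := y0b (- (T *: y)); rewrite memvN memvZ// => /(_ isT).
rewrite !opprK ![_ + T *: y]addrC !sgv_add => [|i|i].
- by rewrite !(psi_funC _ (sgv y)) !linearD /= lerD2l.
- by rewrite yT1// le_max lexx orbT.
- by rewrite yT0// le_max lexx.
Qed.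

Lemma coapprox_psi_eq y0 b y : best_coapproximation Y b y0 ->
  y \in Y -> full_support y ->
  psi_fun y0 (sgv y) = psi_fun b (sgv y).
Proof.
move=> y0b yY fy; apply/le_anti; rewrite coapprox_psi_le//=.
(* The reverse inequality is the same bound applied to [- y]. *)
have sgvN : sgv (- y) = - sgv y by apply/rowP => i; rewrite !mxE sgrN.
rewrite -lerN2 -!linearN /= -sgvN.
by apply: coapprox_psi_le; rewrite ?memvN// => i; rewrite mxE oppr_eq0.
Qed.

End MinimalNormingSet.

End SignVectors.

Theorem theorem2p8 (R : realType) (n m q : nat) (Y : {vspace 'rV[R]_n})
    (A : m.-tuple 'rV[R]_n) (hA : basis_of Y A) (hZ : zero_set A = set0)
    (N : set 'rV[R]_n) (x : 'I_q -> 'rV[R]_n)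
    (hx : N = [set z | exists k : 'I_q, z = x k \/ z = - x k])
    (hN : minimal_norming_set Y N)
    (b : 'rV[R]_n) (alpha : 'I_m -> R) :
  best_coapproximation Y b (\sum_(k < m) alpha k *: tnth A k) <->
  (forall p : 'I_q,
     \sum_(k < m) alpha k * (\sum_(i < n) (tnth A k) 0 i * x p 0 i)
     = \sum_(i < n) b 0 i * x p 0 i).
Proof.
have AY k : tnth A k \in Y by apply: (basis_mem hA); exact: mem_tnth.
have Yi i : exists2 u, u \in Y & u 0 i != 0.
  (* If all of [Y] vanished at [i], so would the basis, putting [i] in the empty zero set. *)
  apply: contrapT => Yi; suff : zero_set A i by rewrite hZ.
  move=> k; apply/eqP/negPn/negP => Aki; apply: Yi.
  by exists (tnth A k).
have n0 := norming_set_dim_gt0 hN.1.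
set y0 := \sum_(k < m) _.
have y0E (z : 'rV[R]_n) : \sum_(k < m) alpha k * (\sum_(i < n) (tnth A k) 0 i * z 0 i)
    = psi_fun y0 z.
  rewrite psi_funC linear_sum; apply: eq_bigr => k _.
  by rewrite linearZ /= psi_funC.
split=> [y0b p|y0x].
  have : N (x p) by rewrite hx; exists p; left.
  (* Minimality makes [x p] the sign vector of a full-support element of [Y]. *)
  rewrite (minimal_norming_setE n0 Yi hN) y0E => -[y [yY fy ->]].
  exact: coapprox_psi_eq y0b yY fy.
apply: (coapprox_of_norming hN.1).
  by apply: memv_suml => k _; rewrite memvZ.
have xE p : psi_fun y0 (x p) = psi_fun b (x p) by rewrite -y0E y0x.
by rewrite hx => z [p [->|->]]; rewrite ?linearN /= xE.
Qed.
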